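(* Let $\mathcal{T}:\mathbb{H}\to\mathbb{H}$ be a quasi-nonexpansive operator with $\operatorname{Fix}(\mathcal{T})\neq\emptyset$ that satisfies the demiclosedness principle. Let $u:[t_0,+\infty)\to\mathbb{H}$ be a strong global solution of $$\frac{du}{dt}=\theta(t)\,[\mathcal{T}(u(t))-u(t)]+f(t),\qquad u(t_0)=u_0\in\mathbb{H},$$ and let $\hat u\in\operatorname{Fix}(\mathcal{T})$ be such that $u(t)$ converges weakly to $\hat u$ as $t\to+\infty$. Suppose that $I-\mathcal{T}$ is metrically subregular at $\hat u$ for $0$ with ball $B(\hat u,r)$ and modulus $\kappa>0$, and that $r>\lim_{t\to+\infty}\|u(t)-\hat u\|$. Then there exist $t'\ge t_0$ and $M_1>0$ such that for all $t\ge t'$, $$\operatorname{dist}^2(u(t),\operatorname{Fix}(\mathcal{T}))\le e^{-\frac1{\kappa^2}\int_{t'}^t\theta(s)ds}\left(M_1\int_{t'}^t\|f(s)\|\,e^{\frac1{\kappa^2}\int_{t'}^s\theta(x)dx}ds+\|u(t')-\hat u\|^2\right).$$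
   Context: $\mathbb{H}$ is a real Hilbert space, $I$ its identity operator, $t_0>0$, $\theta:[t_0,+\infty)\to[0,+\infty)$ is locally integrable, and $f:[t_0,+\infty)\to\mathbb{H}$ belongs to $L^1([t_0,+\infty))$. $\operatorname{Fix}(\mathcal{T})=\{x:\mathcal{T}x=x\}$. $\mathcal{T}$ is quasi-nonexpansive if $\|\mathcal{T}y-x\|\le\|y-x\|$ for all $y\in\mathbb{H}$ and $x\in\operatorname{Fix}(\mathcal{T})$. $\mathcal{T}$ satisfies the demiclosedness principle if, for every sequence $(x_k)$ converging weakly to $x^*$ with $\|\mathcal{T}x_k-x_k\|\to0$, one has $\mathcal{T}x^*=x^*$. A strong global solution is a function $u:[t_0,+\infty)\to\mathbb{H}$ that is absolutely continuous on each interval $[t_0,b]$, $t_0<b<+\infty$, satisfies the differential equation for almost every $t\ge t_0$, and satisfies $u(t_0)=u_0$. Under these hypotheses $\lim_{t\to+\infty}\|u(t)-x\|$ exists for every $x\in\operatorname{Fix}(\mathcal{T})$. $\operatorname{dist}(z,\Omega)$ is the distance from $z$ to $\Omega$, and $B(\hat u,r)=\{z:\|z-\hat u\|<r\}$. For $\hat u\in\operatorname{Fix}(\mathcal{T})$, $I-\mathcal{T}$ is metrically subregular at $\hat u$ for $0$ with ball $B(\hat u,r)$ and modulus $\kappa$ if $\operatorname{dist}(z,\operatorname{Fix}(\mathcal{T}))\le\kappa\|z-\mathcal{T}z\|$ for all $z\in B(\hat u,r)$. *)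

(* Defs.v *)
From HB Require Import structures.
From mathcomp Require Import all_boot all_order all_algebra.
From mathcomp Require Import sesquilinear.
From mathcomp Require Import all_classical all_reals all_analysis.
Set Implicit Arguments.
Unset Strict Implicit.
Unset Printing Implicit Defensive.
Import Order.TTheory GRing.Theory Num.Theory.
Import numFieldNormedType.Exports.
Local Open Scope classical_set_scope.
Local Open Scope ring_scope.

(* A real Hilbert space is a [completeNormedModType R] whose norm comes from
   an inner product, that is, a positive definite symmetric bilinear form. *)
Definition norm_induced_by (R : realType) (H : normedModType R)
    (ip : {dot H for @idfun R}) : Prop :=
  forall x : H, `|x| ^+ 2 = ip x x.

Definition weakly_cvg (R : realType) (H : normedModType R)
    (ip : {dot H for @idfun R}) (I : Type) (F : set_system I)
    (x : I -> H) (l : H) : Prop :=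
  forall y : H, ip (x i) y @[i --> F] --> ip l y.

Definition Fix (X : Type) (T : X -> X) : set X := [set x | T x = x].

Definition quasi_nonexpansive (R : realType) (H : normedModType R)
    (T : H -> H) : Prop :=
  forall y x : H, Fix T x -> `|T y - x| <= `|y - x|.

Definition demiclosedness_principle (R : realType) (H : normedModType R)
    (ip : {dot H for @idfun R}) (T : H -> H) : Prop :=
  forall (x : nat -> H) (xs : H),
    weakly_cvg ip \oo x xs ->
    `|T (x k) - x k| @[k --> \oo] --> (0 : R) ->
    T xs = xs.

Definition dist (R : realType) (H : normedModType R) (z : H) (A : set H) : R :=
  inf [set `|z - a| | a in A].

(* Metric subregularity of [I - T] at [uhat] for [0]. *)
Definition metrically_subregular (R : realType) (H : normedModType R)
    (T : H -> H) (uhat : H) (r kappa : R) : Prop :=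
  forall z : H, ball uhat r z -> dist z (Fix T) <= kappa * `|z - T z|.

(* [lebesgue_measure] lives on the Borel sets.  A Lebesgue measurable function
   is one that is almost everywhere equal to a Borel measurable one, hence the
   following rendering of Lebesgue integrability on [D].  For such a function
   of constant sign, the library's integral, being a supremum over simple
   functions, is the usual Lebesgue integral. *)
Definition ae_integrable (R : realType) (D : set R) (g : R -> R) : Prop :=
  exists2 h : R -> R,
    (@lebesgue_measure R).-integrable D (EFin \o h) &
    {ae @lebesgue_measure R, forall t, D t -> g t = h t}.

Definition locally_integrable_from (R : realType) (t0 : R) (g : R -> R)
    : Prop :=
  forall b : R, t0 < b -> ae_integrable `[t0, b] g.

Definition simple_on (R : realType) (H : normedModType R) (D : set R)
    (s : R -> H) : Prop :=
  finite_set (s @` D) /\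
  forall v : H, measurable (D `&` s @^-1` [set v] : set (measurableTypeR R)).

Definition strongly_measurable (R : realType) (H : normedModType R)
    (D : set R) (f : R -> H) : Prop :=
  exists2 s : nat -> R -> H,
    forall n, simple_on D (s n) &
    {ae @lebesgue_measure R, forall t, D t -> s n t @[n --> \oo] --> f t}.

(* Membership in L^1(D; H), in the sense of Bochner. *)
Definition bochner_integrable (R : realType) (H : normedModType R)
    (D : set R) (f : R -> H) : Prop :=
  strongly_measurable D f /\ ae_integrable D (fun t => `|f t|).

Definition absolutely_continuous_on (R : realType) (H : normedModType R)
    (a b : R) (u : R -> H) : Prop :=
  forall e : R, 0 < e -> exists2 d : R, 0 < d &
    forall (n : nat) (p q : 'I_n -> R),
      (forall i, [/\ a <= p i, p i <= q i & q i <= b]) ->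
      trivIset setT (fun i => `]p i, q i[%classic) ->
      \sum_(i < n) (q i - p i) < d ->
      \sum_(i < n) `|u (q i) - u (p i)| < e.

(* Functions on [t0, +oo) are represented by total functions on [R]; their
   values to the left of [t0] only affect the derivative at [t0] itself, which
   is irrelevant to a condition required almost everywhere. *)
Definition strong_global_solution (R : realType) (H : normedModType R)
    (T : H -> H) (theta : R -> R) (f : R -> H) (t0 : R) (u0 : H)
    (u : R -> H) : Prop :=
  [/\ forall b : R, t0 < b -> absolutely_continuous_on t0 b u,
      {ae @lebesgue_measure R, forall t : R, t0 <= t ->
         is_derive t 1 u (theta t *: (T (u t) - u t) + f t)} &
      u t0 = u0].

(* Main.v *)
Require Import Defs.
From HB Require Import structures.
From mathcomp Require Import all_boot all_order all_algebra.
From mathcomp Require Import sesquilinear.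
From mathcomp Require Import all_classical all_reals all_analysis.
From mathcomp Require Import measurable_realfun.
From mathcomp Require Import ring lra.
Set Implicit Arguments.
Unset Strict Implicit.
Unset Printing Implicit Defensive.
Import Order.TTheory GRing.Theory Num.Theory.
Import numFieldNormedType.Exports.
Local Open Scope classical_set_scope.
Local Open Scope ring_scope.

(** Fix [x] in [Fix T].  Over a short time [h] the solution moves, up to
    [h * |f| + o(h)], to the convex combination [(1 - s) u + s T u] with
    [s = h * theta].  Quasi-nonexpansiveness and the identity
    [|(1 - s) a + s b|^2 = (1 - s) |a|^2 + s |b|^2 - s (1 - s) |a - b|^2] bound
    the upper right Dini derivatives: that of [|u - x|] by [|f|], and, choosing
    [x] within [h^2] of optimal so that no projection on [Fix T] is needed,
    that of [dist(u, Fix T)^2] by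
    [- theta |u - T u|^2 + 2 dist(u, Fix T) |f|].  The first bound shows that
    [|u - uhat|] converges, so [u] eventually stays in the ball; there
    metric subregularity turns the second bound into a linear differential
    inequality for [dist(u, Fix T)^2], to which Gronwall's lemma applies.

    Differential inequalities are integrated through: an absolutely continuous
    function whose upper right Dini derivative is nonpositive almost everywhere
    is nonincreasing. *)

(** * Monotonicity from Dini bounds, and absolute continuity *)

(* The upper right Dini derivative of [G] at [t] is at most [k]. *)
Definition dini_le (R : realType) (G : R -> R) (t k : R) : Prop :=
  forall e, 0 < e -> \forall h \near 0^'+, G (t + h) - G t <= (k + e) * h.

(* [l] lists, from right to left, successive nonoverlapping intervals of
   [[a, s]] contained in [U]. *)
Fixpoint chain (R : realType) (U : set R) (a s : R) (l : seq (R * R)) : Prop :=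
  if l is pq :: l' then
    [/\ pq.1 <= pq.2, pq.2 <= s, `[pq.1, pq.2] `<=` U & chain U a pq.1 l']
  else a <= s.

Lemma chain_le (R : realType) (U : set R) (a s : R) l :
  chain U a s l -> a <= s.
Proof.
elim: l s => [//|pq l IH] s /= [h1 h2 _ /IH h3].
by apply: le_trans h2; apply: le_trans h1.
Qed.

Lemma chainW (R : realType) (U : set R) (a s s' : R) l :
  s <= s' -> chain U a s l -> chain U a s' l.
Proof.
case: l => [|pq l] /= ss'; first by move=> h; exact: le_trans ss'.
by move=> [h1 h2 h3 h4]; split=> //; exact: le_trans ss'.
Qed.

Lemma chain_nth (R : realType) (U : set R) (a s : R) l i : (i < size l)%N ->
  chain U a s l ->
  let pq := nth (0, 0) l i in [/\ a <= pq.1, pq.1 <= pq.2 & pq.2 <= s].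
Proof.
elim: l s i => [//|pq l IH] s [|i] /= il [h1 h2 _ h4].
  by split=> //; exact: chain_le h4.
have [g1 g2 g3] := IH _ _ il h4; split=> //.
exact: (le_trans g3 (le_trans h1 h2)).
Qed.

Lemma chain_sorted (R : realType) (U : set R) (a s : R) l i j :
  (i < j < size l)%N -> chain U a s l ->
  (nth (0, 0) l j).2 <= (nth (0, 0) l i).1.
Proof.
elim: l s i j => [|pq l IH] s i j; first by rewrite ltn0 andbF.
case: j => [|j]; first by rewrite ltn0.
move=> /andP[ij jl] /= [_ _ _ h4]; case: i ij => [|i] ij /=.
  by have [] := chain_nth (jl : (j < size l)%N) h4.
by apply: IH h4; rewrite -ltnS ij.
Qed.

(** Peel off the rightmost interval as [[p, q[]: it is disjoint from the part of [U] left of [p], so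
    the measures add. Cutting [U] at [s] is what carries the induction. *)
Lemma chain_size_le (R : realType) (U : set R) (a s : R) l : open U ->
  chain U a s l ->
  ((\sum_(pq <- l) (pq.2 - pq.1))%:E <=
    @lebesgue_measure R (U `&` `]-oo, s[%classic))%E.
Proof.
move=> oU; have mU : measurable (U : set (measurableTypeR R)).
  exact: open_measurable.
elim: l s => [|[p q] l IH] s /=; first by rewrite big_nil.
move=> [pq qs pqU /IH{}IH]; rewrite big_cons/= EFinD.
have : ((q - p)%:E + @lebesgue_measure R (U `&` `]-oo, p[%classic) <=
    @lebesgue_measure R (U `&` `]-oo, s[%classic))%E.
  have -> : (q - p)%:E = @lebesgue_measure R `[p, q[%classic.
    rewrite lebesgue_measure_itv/= lte_fin; case: ltP => //.
    by move=> qp; congr (_%:E); apply/eqP; rewrite subr_eq0 eq_le qp pq.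
  rewrite -measureU//=.
  - apply: le_measure; rewrite ?inE.
    + by apply: measurableU => //; exact: measurableI.
    + exact: measurableI.
    + move=> x [/=|[Ux]]; rewrite /= !in_itv/=.
      * move=> /andP[px xq]; split; last exact: lt_le_trans qs.
        by apply: pqU; rewrite /= in_itv/= px ltW.
      * by move=> xp; split=> //; exact: (lt_le_trans xp (le_trans pq qs)).
  - exact: measurableI.
  - apply/seteqP; split=> x //= [+ [_]]; rewrite !in_itv/= => /andP[px _].
    by rewrite ltNge px.
by apply: le_trans; rewrite leeD2l.
Qed.

(** A chain inside [U] is an admissible family for absolute continuity, since its total length is at
    most the measure of [U]. *)
Lemma chain_variation_lt (R : realType) (V : normedModType R) (G : R -> V)
    (a b e d : R) (U : set R) l :
  (forall (n : nat) (p q : 'I_n -> R),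
      (forall i, [/\ a <= p i, p i <= q i & q i <= b]) ->
      trivIset setT (fun i => `]p i, q i[%classic) ->
      \sum_(i < n) (q i - p i) < d ->
      \sum_(i < n) `|G (q i) - G (p i)| < e) ->
  open U -> (@lebesgue_measure R U < d%:E)%E -> chain U a b l ->
  \sum_(pq <- l) `|G pq.2 - G pq.1| < e.
Proof.
move=> ac oU Ud cl.
pose p (i : 'I_(size l)) := (nth (0, 0) l i).1.
pose q (i : 'I_(size l)) := (nth (0, 0) l i).2.
rewrite (big_nth (0, 0)) big_mkord; apply: (ac _ p q).
- by move=> i; exact: chain_nth cl.
- apply/trivIsetP => i j _ _.
  wlog ij : i j / (i < j)%N.
    move=> W; case: (ltngtP i j) => [ij|ij|/val_inj->]; last by rewrite eqxx.
      exact: W.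
    by rewrite eq_sym setIC; exact: W.
  move=> _; apply/seteqP; split=> x //=; rewrite !in_itv/= => -[].
  have qp : q j <= p i by apply: chain_sorted cl; rewrite ij ltn_ord.
  by move=> /andP[/ltW px _] /andP[_ /lt_le_trans/(_ (le_trans qp px))]; rewrite ltxx.
- rewrite -lte_fin; apply: le_lt_trans Ud.
  have := chain_size_le oU cl; rewrite (big_nth (0, 0)) big_mkord => /le_trans; apply.
  apply: le_measure; rewrite ?inE; last by move=> x [].
  - by apply: measurableI => //; exact: open_measurable.
  - exact: open_measurable.
Qed.

Lemma absolutely_continuous_uniform (R : realType) (V : normedModType R)
    (a b : R) (G : R -> V) (eta : R) :
  absolutely_continuous_on a b G -> 0 < eta ->
  exists2 d, 0 < d & forall x y, a <= x -> x <= y -> y <= b -> y - x < d ->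
    `|G y - G x| < eta.
Proof.
move=> ac /ac[d d0 acd]; exists d => // x y ax xy yb yxd.
have := acd 1%N (fun=> x) (fun=> y).
rewrite !big_ord_recl !big_ord0 !addr0; apply=> //.
by apply/trivIsetP => i j _ _; rewrite !ord1.
Qed.

Lemma absolutely_continuous_onS (R : realType) (V : normedModType R)
    (a a' b b' : R) (G : R -> V) : a <= a' -> b' <= b ->
  absolutely_continuous_on a b G -> absolutely_continuous_on a' b' G.
Proof.
move=> aa' bb' ac e /ac[d d0 acd]; exists d => // n p q pq; apply: acd => i.
have [ap ? qb] := pq i; split=> //; first exact: le_trans ap.
exact: le_trans bb'.
Qed.

(* Cover the exceptional null set by an open [U] of small measure and move
   rightwards from [a]: outside the null set [G] grows at rate at most [e]; at
   an exceptional point, move along an interval contained in [U].  By absolute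
   continuity the intervals of the second kind contribute at most [e]. *)
Lemma ac_dini_le0 (R : realType) (a b : R) (G : R -> R) :
  a <= b -> absolutely_continuous_on a b G ->
  {ae @lebesgue_measure R, forall t, a <= t < b -> dini_le G t 0} ->
  G b <= G a.
Proof.
move=> ab ac [N [mN N0 NP]].
(* The choice of [e] gives [e * (b - a) + e = e0]: one share for the growth rate, one for the
   exceptional intervals. *)
apply/ler_addgt0Pr => e0 e00; pose e := e0 / (b - a + 1).
have ba1 : 0 < b - a + 1 by rewrite ltr_wpDl// subr_ge0.
have e_gt0 : 0 < e by rewrite divr_gt0.
have ee : e * (b - a) + e = e0 by rewrite -[X in _ + X = _]mulr1 -mulrDr divfK ?gt_eqF.
have [d d0 acd] := ac _ e_gt0.
have [U [oU NU muU]] := lebesgue_regularity_outer mN (eq_ind_r (fun x => x < +oo)%E (ltry 0) N0) d0.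
(* Outer regularity bounds the measure of [U] minus [N]; adding back the null set [N] bounds that of
   [U]. *)
have {}muU : (@lebesgue_measure R U < d%:E)%E.
  apply: le_lt_trans muU; rewrite -[in leLHS](setDUK NU).
  apply: le_trans (measureU2 _ _ _) _ => //.
    apply: measurableD => //; exact: open_measurable.
  by rewrite [X in (X + _)%E](_ : _ = 0%E)// add0e.
(* The arbitrary slack [eta] lets [P] survive the passage to a supremum, by continuity of [G]. *)
pose P s := forall eta, 0 < eta -> exists2 l, chain U a s l &
  G s - G a <= e * (s - a) + \sum_(pq <- l) `|G pq.2 - G pq.1| + eta.
suff Pb : P b.
  apply/ler_addgt0Pr => eta /Pb[l cl /[!lerBlDl] /le_trans]; apply.
  have := chain_variation_lt acd oU muU cl => /ltW le1.
  by rewrite -ee; lra.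
pose S := [set s | [/\ a <= s, s <= b & P s]].
have Sa : S a.
  by split=> // eta eta0; exists [::]; rewrite /= ?lexx// big_nil !subrr mulr0; lra.
have ubS : has_ubound S by exists b => s [].
have supS : has_sup S by split=> //; exists a.
pose x := sup S.
have ax : a <= x by exact: ub_le_sup.
have xb : x <= b by apply: ge_sup; [exists a|move=> s []].
have Px : P x.
  move=> eta eta0.
  have [dl dl0 cont] := absolutely_continuous_uniform ac (divr_gt0 eta0 (ltr0n _ 2)).
  have [s [as' sb Ps] xs] := sup_adherent dl0 supS.
  have sx : s <= x by apply: ub_le_sup.
  have [l cl le1] := Ps _ (divr_gt0 eta0 (ltr0n _ 2)).
  exists l; first exact: chainW cl.
  have := cont _ _ as' sx xb; rewrite -/x in xs.
  rewrite ltrBlDr addrC -ltrBlDr => /(_ xs) /ltW /ler_normlW.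
  have : e * (s - a) <= e * (x - a) by rewrite ler_pM2l// lerD2r.
  lra.
move: xb; rewrite le_eqVlt => /predU1P[<-//|xb].
suff [s xs Ss] : exists2 s, x < s & S s.
  by have : s <= x by [exact: ub_le_sup]; rewrite leNgt xs.
have [Nx|Nx] := pselect (N x).
- have : \forall y \near x, U y by apply: open_nbhs_nbhs; split=> //; exact: NU.
  move=> /nbhs_ballP[rho /= rho0 ballU].
  pose s := x + Num.min (rho / 2) (b - x).
  have m0 : 0 < Num.min (rho / 2) (b - x) by rewrite lt_min divr_gt0//= subr_gt0.
  have xs : x < s by rewrite /s ltrDl.
  have sb : s <= b by rewrite /s -lerBrDl ge_min lexx orbT.
  have srho : s - x < rho.
    rewrite /s addrC addKr gt_min; apply/orP; left.
    by rewrite ltr_pdivrMr// ltr_pMr// ltr1n.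
  exists s => //; split=> //; first exact: le_trans (ltW xs).
  move=> eta eta0; have [l cl le1] := Px _ eta0.
  exists ((x, s) :: l); last first.
    rewrite big_cons/=; have := ler_norm (G s - G x).
    have : e * (x - a) <= e * (s - a) by rewrite ler_pM2l// lerD2r ltW.
    lra.
  split=> //=; first exact: ltW.
  move=> z /=; rewrite in_itv/= => /andP[xz zs]; apply: ballU.
  rewrite /ball/= distrC ger0_norm ?subr_ge0//.
  by apply: le_lt_trans srho; rewrite lerD2r.
- have dini : dini_le G x 0.
    by move/subsetCl : NP => /(_ x Nx)/=; apply; rewrite ax xb.
  have : \forall h \near 0^'+, [/\ 0 < h, h < b - x & G (x + h) - G x <= e * h].
    near=> h; split.
    + by near: h; exact: nbhs_right_gt.
    + by near: h; apply: nbhs_right_lt; rewrite subr_gt0.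
    + by near: h; have := dini _ e_gt0; rewrite add0r.
  move=> /filter_ex[h [h0 hb hG]].
  exists (x + h); first by rewrite ltrDl.
  split; [by rewrite (le_trans ax)// lerDl ltW|by rewrite -lerBrDl ltW|].
  move=> eta eta0; have [l cl le1] := Px _ eta0.
  exists l; first by apply: chainW cl; rewrite lerDl ltW.
  lra.
Unshelve. all: by end_near. Qed.

(** Serves to transfer absolute continuity to Lipschitz images, differences and products of bounded
    functions. *)
Lemma ac_dominated (R : realType) (V V' : normedModType R) (a b c1 c2 : R)
    (u : R -> V) (v : R -> V') (w : R -> R) :
  0 <= c1 -> 0 <= c2 ->
  absolutely_continuous_on a b u -> absolutely_continuous_on a b v ->
  (forall x y, a <= x -> x <= y -> y <= b ->
    `|w y - w x| <= c1 * `|u y - u x| + c2 * `|v y - v x|) ->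
  absolutely_continuous_on a b w.
Proof.
move=> c10 c20 acu acv uvw e e0.
have c0 : 0 < c1 + c2 + 1 by rewrite ltr_wpDl// addr_ge0.
pose e' := e / (c1 + c2 + 1); have e'0 : 0 < e' by rewrite divr_gt0.
have [d1 d10 acu1] := acu _ e'0; have [d2 d20 acv2] := acv _ e'0.
exists (Num.min d1 d2); first by rewrite lt_min d10.
move=> n p q pq tpq; rewrite lt_min => /andP[lt1 lt2].
have su := acu1 _ _ _ pq tpq lt1; have sv := acv2 _ _ _ pq tpq lt2.
apply: (@le_lt_trans _ _ (c1 * e' + c2 * e')); last first.
  by rewrite -mulrDl mulrC /e' -mulrA gtr_pMr// mulrC ltr_pdivrMr// mul1r ltrDl.
apply: (@le_trans _ _ (c1 * (\sum_(i < n) `|u (q i) - u (p i)|) +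
  c2 * \sum_(i < n) `|v (q i) - v (p i)|)).
  rewrite !mulr_sumr -big_split/= ler_sum// => i _.
  by have [? ? ?] := pq i; exact: uvw.
by apply: lerD; apply: ler_wpM2l => //; exact: ltW.
Qed.

(** * Expansions from the right and primitives *)

Lemma is_derive_near0_right (R : realType) (V : normedModType R) (u : R -> V)
    (t : R) (v : V) (e : R) : is_derive t 1 u v -> 0 < e ->
  \forall h \near 0^'+, `|u (t + h) - u t - h *: v| <= e * h.
Proof.
move=> [dut <-] e0.
move: dut => /cvgrPdist_le /(_ _ e0); rewrite near_withinE => dl.
near=> h; have h0 : 0 < h by near: h; exact: nbhs_right_gt.
have : `|'D_1 u t - h^-1 *: ((u \o shift t) (h *: 1) - u t)| <= e.
  by near: h; apply: filterS dl => h + h0; apply; rewrite gt_eqF.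
have -> : (u \o shift t) (h *: 1) = u (t + h).
  by rewrite /= [h *: 1]mulr1 addrC.
rewrite distrC -[X in _ * X](gtr0_norm h0) => le1.
have -> : u (t + h) - u t - h *: 'D_1 u t =
    h *: (h^-1 *: (u (t + h) - u t) - 'D_1 u t).
  by rewrite scalerBr scalerA mulfV ?gt_eqF// scale1r.
by rewrite normrZ mulrC ler_wpM2r.
Unshelve. all: by end_near. Qed.

(** Starting from minus infinity lets one function serve every base point, for [k] integrable on the
    whole line. *)
Definition primitive (R : realType) (k : R -> R) (y : R) : R :=
  \int[@lebesgue_measure R]_(s in `]-oo, y]) k s.

(** Lebesgue's differentiation theorem. *)
Lemma primitive_is_derive (R : realType) (k : R -> R) :
  (@lebesgue_measure R).-integrable setT (EFin \o k) ->
  {ae @lebesgue_measure R, forall y : R, is_derive y 1 (primitive k) (k y)}.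
Proof.
move=> ik; have ik' y : (@lebesgue_measure R).-integrable `]-oo, y] (EFin \o k).
  exact: integrableS ik.
have := FTC1Ny ik' (open_integrable_locally openT ik).
apply: (@filterS _ _ (ae_filter_ringOfSetsType _)) => y [dy ky]; split=> //.
by rewrite -derive1E.
Qed.

Lemma primitiveB (R : realType) (k : R -> R) (p q : R) :
  (@lebesgue_measure R).-integrable setT (EFin \o k) -> p <= q ->
  primitive k q - primitive k p = \int[@lebesgue_measure R]_(s in `[p, q]) k s.
Proof.
move=> ik pq; rewrite /primitive Rintegral_itvB//.
  by rewrite Rintegral_itv_obnd_cbnd//; exact: integrableS ik.
exact: integrableS ik.
Qed.

Lemma primitive_homo (R : realType) (k : R -> R) (p q : R) :
  (@lebesgue_measure R).-integrable setT (EFin \o k) ->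
  (forall s, 0 <= k s) -> p <= q -> primitive k p <= primitive k q.
Proof.
by move=> ik k0 pq; rewrite -subr_ge0 primitiveB// Rintegral_ge0.
Qed.

(** The union of the intervals has measure below [d], and the integral of the absolute value of [k]
    over sets of small measure is small. *)
Lemma ac_primitive (R : realType) (k : R -> R) (a b : R) :
  (@lebesgue_measure R).-integrable setT (EFin \o k) ->
  absolutely_continuous_on a b (primitive k).
Proof.
move=> ik e e0; have [d [d0 kd]] := integral_normr_continuous ik e0.
exists d => // n p q pq tpq ltd.
pose A := \big[setU/set0]_(i < n) `]p i, q i[%classic : set R.
have mA : measurable (A : set (measurableTypeR R)).
  by apply: bigsetU_measurable => i _.
have lt_e : \int[@lebesgue_measure R]_(x in A) `|k x| < e.
  apply: kd => //; rewrite /A measure_bigsetU_ord//.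
  apply: le_lt_trans (_ : (\sum_(i < n) (q i - p i))%:E < _)%E; last by rewrite lte_fin.
  rewrite -sumEFin; apply: lee_sum => i _; rewrite [leLHS]lebesgue_measure_itv/=.
  by case: ifPn => // _; rewrite lee_fin subr_ge0; have [] := pq i.
apply: le_lt_trans lt_e; rewrite -lee_fin.
have ink B : measurable B -> (@lebesgue_measure R).-integrable B (EFin \o (fun x => `|k x|)).
  move=> mB; have := integrable_abse (integrableS _ _ _ ik) => /(_ B).
  by apply=> //; exact: measurableT.
have -> : \int[@lebesgue_measure R]_(x in A) `|k x| =
    \sum_(i < n) \int[@lebesgue_measure R]_(x in `]p i, q i[) `|k x|.
  rewrite /Rintegral integral_bigsetU_EFin//=; first last.
  - by have /(_ _ mA)/integrableP[] := ink.
  - exact: sub_trivIset tpq.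
  - exact: index_enum_uniq.
 
  rewrite -sum_fine// => i _; apply: integrable_fin_num => //; exact: ink.
rewrite lee_fin; apply: ler_sum => i _; have [_ pqi _] := pq i.
rewrite primitiveB//.
apply: le_trans (le_normr_Rintegral _ _) _ => //; first exact: integrableS ik.
rewrite -Rintegral_itv_bndo_bndc; last exact: ink.
by rewrite -Rintegral_itv_obnd_cbnd//; exact: ink.
Qed.

(** * Integrals of nonnegative functions that need not be measurable *)

Section nonmeasurable_integrand.
Import HBNNSimple.

(** Holds without measurability because the integral is a supremum over simple functions: those
    below [f] on [A] are also below [g] on [B]. *)
Lemma ge0_integral_subset_mono d (X : measurableType d) (R : realType)
    (mu : {measure set X -> \bar R}) (A B : set X) (f g : X -> \bar R) :
  (forall x, A x -> (0 <= f x)%E) -> (forall x, B x -> (0 <= g x)%E) ->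
  (forall x, A x -> (f x <= (g \_ B) x)%E) ->
  (\int[mu]_(x in A) f x <= \int[mu]_(x in B) g x)%E.
Proof.
move=> f0 g0 fg; rewrite !ge0_integralE//.
apply: ge_ereal_sup => _ [h hf <-]; apply: ereal_sup_ubound; exists h => // x.
apply: le_trans (hf x) _; rewrite [leLHS]patchE.
have [/set_mem/fg//|_] := boolP (x \in A).
by rewrite patchE; case: ifPn => // /set_mem /g0.
Qed.

(* The library's [ge0_ae_eq_integral] requires both functions to be measurable,
   whereas here [f] need not be Borel measurable. *)
Lemma ge0_ae_eq_integral_nonmeasurable d (X : measurableType d) (R : realType)
    (mu : {measure set X -> \bar R}) (D : set X) (f h : X -> \bar R) :
  measurable D -> measurable_fun D h ->
  (forall x, D x -> (0 <= f x)%E) -> (forall x, D x -> (0 <= h x)%E) ->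
  {ae mu, forall x, D x -> f x = h x} ->
  (\int[mu]_(x in D) f x = \int[mu]_(x in D) h x)%E.
Proof.
move=> mD mh f0 h0 [N [mN N0 /subsetCl NP]].
have fh x : ~ N x -> D x -> f x = h x by move=> /NP; exact.
apply/eqP; rewrite eq_le; apply/andP; split.
(* A simple [g] below [f] is measurable, so its integral ignores [N]; off [N] it lies below [h]. *)
- rewrite [leLHS]ge0_integralE//; apply: ge_ereal_sup => _ [g gf <-].
  have g0 x : (0 <= (g x)%:E)%E by rewrite lee_fin; exact: fun_ge0.
  rewrite -integralT_nnsfun (ge0_negligible_integral mN)//; last first.
    exact/measurable_EFinP.
  apply: ge0_integral_subset_mono => // x [_ Nx].
  apply: le_trans (gf x) _; rewrite !patchE; case: ifPn => // /set_mem Dx.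
  by rewrite fh.
(* Here [h] is the measurable one, so [N] can be removed from its domain; on the rest it equals
   [f]. *)
- rewrite (ge0_negligible_integral mN)//.
  rewrite (eq_integral f); last by move=> x /set_mem[Dx Nx]; rewrite fh.
  apply: ge0_integral_subset_mono => // x [Dx _]; first exact: f0.
  by rewrite patchE mem_set.
Qed.

End nonmeasurable_integrand.

(** * Calculus of Dini bounds and Gronwall's inequality *)

Lemma dini_leM (R : realType) (phi A : R -> R) (s k a : R) :
  dini_le phi s k -> is_derive s 1 A a -> 0 <= phi s -> (forall t, 0 <= A t) ->
  dini_le (fun t => phi t * A t) s (k * A s + phi s * a).
Proof.
move=> dphi dA phi0 A0 e e0.
(* [e] is spent in thirds: [e1] for the error of [phi], [e2] for that of [A], and the last for the
   second-order term controlled by [C]. *)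
have As1 : 0 < A s + 1 by rewrite ltr_wpDl.
have ps1 : 0 < phi s + 1 by rewrite ltr_wpDl.
pose e1 := e / 3 / (A s + 1); pose e2 := Num.min 1 (e / 3 / (phi s + 1)).
have e10 : 0 < e1 by rewrite !divr_gt0.
have e20 : 0 < e2 by rewrite lt_min ltr01 !divr_gt0.
have e2le1 : e2 <= 1 by rewrite ge_min lexx.
have e1A : e1 * A s <= e / 3.
  by rewrite /e1 -(mulrA (e / 3)) ger_pMr ?divr_gt0// mulrC ler_pdivrMr// mul1r lerDl.
have e2phi : phi s * e2 <= e / 3.
  apply: (@le_trans _ _ (phi s * (e / 3 / (phi s + 1)))).
    by rewrite ler_wpM2l// ge_min lexx orbT.
  by rewrite [leLHS]mulrC -(mulrA (e / 3)) ger_pMr ?divr_gt0// mulrC ler_pdivrMr// mul1r lerDl.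
pose C := `|k + e1| * (`|a| + 1) + 1.
have C0 : 0 < C by rewrite ltr_wpDl// mulr_ge0// addr_ge0.
near=> h.
have h0 : 0 < h by near: h; exact: nbhs_right_gt.
have hC : h < e / 3 / C by near: h; apply: nbhs_right_lt; rewrite !divr_gt0.
have {hC}hC : C * h <= e / 3 by rewrite mulrC -ler_pdivlMr// ltW.
have hphi : phi (s + h) - phi s <= (k + e1) * h by near: h; exact: dphi.
have : `|A (s + h) - A s - h * a| <= e2 * h.
  by near: h; exact: is_derive_near0_right.
rewrite ler_norml => /andP[A1 A2].
have hA : A (s + h) - A s <= (a + e2) * h by lra.
have hA' : `|A (s + h) - A s| <= (`|a| + 1) * h.
  have le1 : e2 * h <= h by rewrite ger_pMl.
  have := ler_wpM2r (ltW h0) (ler_norm a).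
  have := ler_wpM2r (ltW h0) (ler_norm (- a)); rewrite normrN => n1 n2.
  by rewrite ler_norml; apply/andP; split; lra.
(* The increment of the product is [(phi (s + h) - phi s) * A (s + h) + phi s * (A (s + h) - A s)];
   nonnegative factors preserve the one-sided bounds. *)
have t1 : (phi (s + h) - phi s) * A (s + h) <= (k + e1) * h * A (s + h).
  exact: ler_wpM2r.
have t2 : phi s * (A (s + h) - A s) <= phi s * ((a + e2) * h) by exact: ler_wpM2l.
have t3 : (k + e1) * (A (s + h) - A s) <= C * h.
  apply: le_trans (ler_norm _) _; rewrite normrM.
  apply: (@le_trans _ _ (`|k + e1| * ((`|a| + 1) * h))); first exact: ler_wpM2l.
  by rewrite mulrA; apply: ler_wpM2r; [exact: ltW|rewrite /C lerDl].
have t4 := ler_wpM2l (ltW h0) (le_trans t3 hC).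
have t5 := ler_wpM2l (ltW h0) e1A.
have t6 := ler_wpM2l (ltW h0) e2phi.
lra.
Unshelve. all: by end_near. Qed.

Lemma dini_leB (R : realType) (F K : R -> R) (s k M k' : R) :
  0 <= M -> dini_le F s k -> is_derive s 1 K k' ->
  dini_le (fun t => F t - M * K t) s (k - M * k').
Proof.
move=> M0 dF dK e e0.
have M1 : 0 < M + 1 by rewrite ltr_wpDl.
pose e1 := e / 2 / (M + 1).
have e10 : 0 < e1 by rewrite !divr_gt0.
have e20 : 0 < e / 2 by rewrite divr_gt0.
have e1M : M * e1 <= e / 2.
  by rewrite [leLHS]mulrC /e1 -(mulrA (e / 2)) ger_pMr ?divr_gt0// mulrC ler_pdivrMr// mul1r lerDl.
near=> h.
have h0 : 0 < h by near: h; exact: nbhs_right_gt.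
have hF : F (s + h) - F s <= (k + e / 2) * h by near: h; exact: dF.
have : `|K (s + h) - K s - h * k'| <= e1 * h.
  by near: h; exact: is_derive_near0_right.
rewrite ler_norml => /andP[K1 K2].
have t1 := ler_wpM2l M0 K1.
have t2 := ler_wpM2l (ltW h0) e1M.
lra.
Unshelve. all: by end_near. Qed.

Lemma primitive_le (R : realType) (k : R -> R) (y : R) :
  (@lebesgue_measure R).-integrable setT (EFin \o k) -> (forall s, 0 <= k s) ->
  primitive k y <= \int[@lebesgue_measure R]_s k s.
Proof.
move=> ik k0; apply: fine_le.
- by apply: integrable_fin_num => //; exact: integrableS ik.
- exact: integrable_fin_num.
- apply: ge0_subset_integral => //; last by move=> s _; rewrite lee_fin.
  exact: measurable_int ik.
Qed.

(** Convexity of the exponential: its tangent at [y], evaluated at [x]. *)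
Lemma expRB_le (R : realType) (x y : R) : expR y - expR x <= expR y * (y - x).
Proof.
have := expR_ge1Dx (x - y) => /(ler_wpM2l (expR_ge0 y)).
rewrite -expRD subrKC; lra.
Qed.

(** With the integrating factor [A] and a primitive [K] of [g * A], the function [phi * A - M * K]
    has Dini derivative at most zero almost everywhere, so [ac_dini_le0] compares its values at [p]
    and [q]. The bound [B] serves the absolute continuity of [phi * A]. *)
Lemma gronwall (R : realType) (p q c M B : R) (phi th g : R -> R) :
  p <= q -> 0 <= c -> 0 <= M ->
  (forall s, p <= s <= q -> 0 <= phi s <= B) ->
  absolutely_continuous_on p q phi ->
  (forall s, 0 <= th s) -> (forall s, 0 <= g s) ->
  (@lebesgue_measure R).-integrable setT (EFin \o th) ->
  (@lebesgue_measure R).-integrable setT (EFin \o g) ->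
  {ae @lebesgue_measure R, forall s, p <= s < q ->
    dini_le phi s (- (c * th s * phi s) + M * g s)} ->
  phi q <= expR (- (c * \int[@lebesgue_measure R]_(s in `[p, q]) th s)) *
    (M * \int[@lebesgue_measure R]_(s in `[p, q])
      (g s * expR (c * \int[@lebesgue_measure R]_(x in `[p, s]) th x)) +
     phi p).
Proof.
move=> pq c0 M0 phiB acphi th0 g0 ith ig dphi.
pose Th := primitive th; pose A y := expR (c * (Th y - Th p)).
have A0 y : 0 <= A y by exact: expR_ge0.
(* [Amax] bounds the integrating factor on the whole line, so that [g * A] is integrable there and
   has a primitive. *)
pose Amax := expR (c * (\int[@lebesgue_measure R]_s th s - Th p)).
have AA y : A y <= Amax.
  by rewrite ler_expR ler_wpM2l// lerD2r primitive_le.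
have ndA : nondecreasing_fun A.
  by move=> x y xy; rewrite ler_expR ler_wpM2l// lerD2r primitive_homo.
pose k s := g s * A s.
have ik : (@lebesgue_measure R).-integrable setT (EFin \o k).
  rewrite (_ : EFin \o k = (EFin \o g) \* (EFin \o A))%E//.
  apply: integrableMl => //; first exact: nondecreasing_measurable.
  exists Amax; split; first exact: num_real.
  move=> x Ax y _ /=; rewrite ger0_norm//.
  by apply: le_trans (AA _) (ltW Ax).
pose K := primitive k.
have acA : absolutely_continuous_on p q A.
  have acTh := ac_primitive p q ith.
  have cA0 : 0 <= Amax * c by rewrite mulr_ge0// expR_ge0.
  apply: (ac_dominated cA0 (lexx 0) acTh acTh) => x y _ xy _.
  rewrite mul0r addr0 !ger0_norm ?subr_ge0; [|exact: primitive_homo|exact: ndA].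
  apply: le_trans (expRB_le _ _) _.
  have -> : c * (Th y - Th p) - c * (Th x - Th p) = c * (Th y - Th x) by ring.
  rewrite mulrA; apply: ler_wpM2r; first by rewrite subr_ge0 primitive_homo.
  by apply: ler_wpM2r => //; exact: AA.
have B0 : 0 <= B.
  have /andP[h1 h2] : 0 <= phi p <= B by apply: phiB; rewrite lexx pq.
  exact: le_trans h2.
have acW : absolutely_continuous_on p q (fun t => phi t * A t).
  have Amax0 : 0 <= Amax by exact: expR_ge0.
  apply: (ac_dominated Amax0 B0 acphi acA) => x y px xy yq.
  have -> : phi y * A y - phi x * A x =
    A y * (phi y - phi x) + phi x * (A y - A x) by ring.
  apply: le_trans (ler_normD _ _) _; rewrite !normrM; apply: lerD.
    by apply: ler_wpM2r => //; rewrite ger0_norm// AA.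
  have /andP[h1 h2] : 0 <= phi x <= B.
    by apply: phiB; rewrite px (le_trans xy).
  by apply: ler_wpM2r => //; rewrite ger0_norm.
pose G y := phi y * A y - M * K y.
have acG : absolutely_continuous_on p q G.
  have acK := ac_primitive p q ik.
  apply: (ac_dominated ler01 M0 acW acK) => x y _ _ _.
  have -> : G y - G x = (phi y * A y - phi x * A x) + (- M * (K y - K x)).
    by rewrite /G; ring.
  apply: le_trans (ler_normD _ _) _.
  by rewrite normrM normrN (ger0_norm M0) mul1r.
have dG : {ae @lebesgue_measure R, forall t, p <= t < q -> dini_le G t 0}.
  have dTh := primitive_is_derive ith; have dK := primitive_is_derive ik.
  apply: (@filterS3 _ _ (ae_filter_ringOfSetsType _) _ _ _ _ _ dphi dTh dK).
  move=> t /= dphit dTht dKt pt.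
  have dA : is_derive t 1 A (c * th t * A t).
    have d1 : is_derive t 1 (fun y => c * (Th y - Th p)) (c * th t).
      have := is_deriveZ c (is_deriveB dTht (is_derive_cst (Th p) t 1)).
      by rewrite subr0.
    have := is_derive1_comp (is_derive_expR _) d1.
    by rewrite mulrC.
  have /andP[phit0 _] : 0 <= phi t <= B.
    by apply: phiB; case/andP: pt => -> /ltW ->.
  (* The derivative of [A] cancels the term in [c * th], and that of [K] cancels the source. *)
  have := dini_leB M0 (dini_leM (dphit pt) dA phit0 A0) dKt.
  by congr dini_le; rewrite /k; ring.
have := ac_dini_le0 pq acG dG; rewrite /G.
have -> : A p = 1 by rewrite /A subrr mulr0 expR0.
rewrite mulr1 lerBlDl => le1.
have -> : \int[@lebesgue_measure R]_(s in `[p, q]) th s = Th q - Th p.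
  by rewrite primitiveB.
have -> : \int[@lebesgue_measure R]_(s in `[p, q])
      (g s * expR (c * \int[@lebesgue_measure R]_(x in `[p, s]) th x)) =
   K q - K p.
  rewrite primitiveB//; apply: eq_Rintegral => s /set_mem/=.
  by rewrite in_itv/= => /andP[ps _]; rewrite -primitiveB.
rewrite expRN -/(A q) mulrC ler_pdivlMr ?expR_gt0//.
by apply: le_trans le1 _; lra.
Qed.

(** * The convexity identity and the distance to a set *)

Lemma convex_comb_normE (R : realType) (H : normedModType R)
    (ip : {dot H for @idfun R}) (a b : H) (s : R) : norm_induced_by ip ->
  `|(1 - s) *: a + s *: b| ^+ 2 =
  (1 - s) * `|a| ^+ 2 + s * `|b| ^+ 2 - s * (1 - s) * `|b - a| ^+ 2.
Proof.
move=> ipn; rewrite !ipn !(linearBl, linearDl, linearBr, linearDr).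
rewrite !(linearZl_LR, linearZr_LR)/= (hermC ip b a) expr0 mul1r/=.
rewrite /GRing.scale/=; ring.
Qed.

Section dist_theory.
Context (R : realType) (H : normedModType R).
Implicit Types (z w x : H) (A : set H).

Let lbdist z A : has_lbound [set `|z - a| | a in A].
Proof. by exists 0 => _ [a _ <-]. Qed.

Lemma dist_le z x A : A x -> dist z A <= `|z - x|.
Proof. by move=> Ax; apply: ge_inf => //; exists x. Qed.

Lemma dist_ge0 z A : A !=set0 -> 0 <= dist z A.
Proof.
by move=> [x Ax]; apply: lb_le_inf; [exists `|z - x|, x|move=> _ [a _ <-]].
Qed.

Lemma dist_approx z A (e : R) : A !=set0 -> 0 < e ->
  exists2 x, A x & `|z - x| < dist z A + e.
Proof.
move=> [x0 Ax0] e0.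
have hi : has_inf [set `|z - a| | a in A] by split=> //; exists `|z - x0|, x0.
by have [_ [x Ax <-] lt] := inf_adherent e0 hi; exists x.
Qed.

(** A point nearly optimal for one argument competes for the other. *)
Lemma dist_lipschitz z w A : A !=set0 -> `|dist z A - dist w A| <= `|z - w|.
Proof.
move=> A0; suff W z' w' : dist z' A - dist w' A <= `|z' - w'|.
  by rewrite ler_norml W andbT lerNl opprB distrC W.
apply/ler_addgt0Pr => e e0; have [x Ax lt] := dist_approx w' A0 e0.
have := dist_le z' Ax; have := ler_distD w' z' x; lra.
Qed.

End dist_theory.

(** * Dini bounds along the trajectory *)

(** The error in the derivative does not involve [x], so one range of [h] serves all [x]; this
    allows [x] to be chosen depending on [h] later. *)
Lemma solution_expansion (R : realType) (H : normedModType R) (T : H -> H)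
    (u : R -> H) (t th : R) (F : H) (e : R) :
  is_derive t 1 u (th *: (T (u t) - u t) + F) -> 0 < e ->
  \forall h \near 0^'+, forall x, `|u (t + h) - x| <=
    `|(1 - h * th) *: (u t - x) + (h * th) *: (T (u t) - x)| + h * (`|F| + e).
Proof.
move=> du e0; near=> h.
have h0 : 0 < h by near: h; exact: nbhs_right_gt.
have : `|u (t + h) - u t - h *: (th *: (T (u t) - u t) + F)| <= e * h.
  by near: h; exact: is_derive_near0_right.
set err := _ - _ - _ => lerr x.
have -> : u (t + h) - x = ((1 - h * th) *: (u t - x) + (h * th) *: (T (u t) - x))
    + (h *: F + err).
  rewrite /err scalerBl scale1r; set D := T (u t) - x; set d := u t - x.
  have -> : T (u t) - u t = D - d by rewrite /D /d opprB addrA subrK.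
  rewrite (_ : h *: (_ + _) = (h * th) *: D - (h * th) *: d + h *: F); last first.
 by rewrite [LHS]scalerDr scalerA scalerBr.
  set a := (h * th) *: d; set b := (h * th) *: D; set c := h *: F.
  have -> : d - a + b = d + (b - a) by rewrite addrAC addrA.
  rewrite -[RHS]addrA [X in _ = _ + X]addrA [X in _ = _ + X]addrC subrK.
  by rewrite /d [RHS]addrC addrA subrK.
apply: le_trans (ler_normD _ _) _; rewrite lerD2l.
apply: le_trans (ler_normD _ _) _; rewrite normrZ (gtr0_norm h0) mulrDr lerD2l.
by rewrite mulrC in lerr.
Unshelve. all: by end_near. Qed.

Lemma near0_right_mul_le (R : realType) (k c : R) : 0 < c ->
  \forall h \near 0^'+, h * k <= c.
Proof.
move=> c0; have k1 : 0 < `|k| + 1 by rewrite ltr_wpDl.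
near=> h; have h0 : 0 < h by near: h; exact: nbhs_right_gt.
have : h < c / (`|k| + 1) by near: h; apply: nbhs_right_lt; rewrite divr_gt0.
rewrite ltr_pdivlMr// => /ltW; apply: le_trans; rewrite (ler_wpM2l (ltW h0))//.
by rewrite (le_trans (ler_norm _))// lerDl.
Unshelve. all: by end_near. Qed.

(** Once [h * th] is at most 1 the combination is convex, and quasi-nonexpansiveness bounds its norm
    by that of [u t - x]. *)
Lemma dini_dist_fix (R : realType) (H : normedModType R) (T : H -> H)
    (u : R -> H) (t th : R) (F x : H) :
  quasi_nonexpansive T -> Fix T x -> 0 <= th ->
  is_derive t 1 u (th *: (T (u t) - u t) + F) ->
  dini_le (fun s => `|u s - x|) t `|F|.
Proof.
move=> qT Tx th0 du e e0; near=> h.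
have h0 : 0 < h by near: h; exact: nbhs_right_gt.
have h1 : h * th <= 1 by near: h; exact: near0_right_mul_le.
have : `|u (t + h) - x| <=
    `|(1 - h * th) *: (u t - x) + (h * th) *: (T (u t) - x)| + h * (`|F| + e).
  by near: h; apply: filterS (solution_expansion du e0) => h; apply.
rewrite lerBlDr => /le_trans; apply.
rewrite [leRHS]addrC (mulrC h (_ + _)) lerD2r.
apply: le_trans (ler_normD _ _) _.
have s0 : 0 <= h * th by rewrite mulr_ge0// ltW.
rewrite 2!normrZ (@ger0_norm _ (1 - _)) ?subr_ge0// (ger0_norm s0).
have := ler_wpM2l s0 (qT (u t) x Tx); lra.
Unshelve. all: by end_near. Qed.

(** The convexity identity leaves a gain of [s * (1 - s)] times the squared residual, which the
    hypothesis bounds below through [c]. Choosing [x] after [h] costs only terms of order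
    [h ^+ 2]. *)
Lemma dini_dist_sqr (R : realType) (H : normedModType R)
    (ip : {dot H for @idfun R}) (T : H -> H) (u : R -> H) (t th c r : R) (F : H) :
  norm_induced_by ip -> quasi_nonexpansive T -> Fix T !=set0 ->
  0 <= th -> 0 <= c ->
  is_derive t 1 u (th *: (T (u t) - u t) + F) ->
  c * dist (u t) (Fix T) ^+ 2 <= `|u t - T (u t)| ^+ 2 ->
  dist (u t) (Fix T) <= r ->
  dini_le (fun s => dist (u s) (Fix T) ^+ 2) t
    (- (c * th * dist (u t) (Fix T) ^+ 2) + 2 * r * `|F|).
Proof.
move=> ipn qT T0 th0 c0 du; set D := dist (u t) (Fix T) => subreg Dr e e0.
have D0 : 0 <= D by exact: dist_ge0.
have D1 : 0 < D + 1 by rewrite ltr_wpDl.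
(* Half of [e] absorbs [2 * D * e1]; the other half absorbs [h * C]. *)
pose e1 := e / 4 / (D + 1).
have e10 : 0 < e1 by rewrite !divr_gt0.
have De1 : D * e1 <= e / 4.
  by rewrite [leLHS]mulrC /e1 -(mulrA (e / 4)) ger_pMr ?divr_gt0// mulrC
    ler_pdivrMr// mul1r lerDl.
pose w := `|F| + e1; have w0 : 0 <= w by rewrite addr_ge0// ltW.
(* [C] collects the coefficients of all terms of order [h ^+ 2] and higher, the higher ones reduced
   by [h <= 1]. *)
pose C := 2 * D + 1 + th ^+ 2 * c * D ^+ 2 + 2 * w + w ^+ 2.
near=> h.
have h0 : 0 < h by near: h; exact: nbhs_right_gt.
have h1 : h <= 1 by near: h; exact: nbhs_right_le.
have s1 : h * th <= 1 by near: h; exact: near0_right_mul_le.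
have hC : h * C <= e / 2.
  by near: h; apply: near0_right_mul_le; rewrite divr_gt0.
have le_norm : forall x, `|u (t + h) - x| <=
    `|(1 - h * th) *: (u t - x) + (h * th) *: (T (u t) - x)| + h * w.
  by near: h; exact: solution_expansion.
have hh0 : 0 < h ^+ 2 by rewrite exprn_gt0.
have [x Tx lt_x] := dist_approx (u t) T0 hh0.
have := le_trans (dist_le (u (t + h)) Tx) (le_norm x).
set D' := dist (u (t + h)) _.
have D'0 : 0 <= D' by exact: dist_ge0.
set s := h * th; have s0 : 0 <= s by rewrite mulr_ge0// ltW.
pose a := u t - x; pose b := T (u t) - x.
rewrite -/a -/b -/s in s1 lt_x *.
set N := `|_ + _| => D'N.
have N0 : 0 <= N by exact: normr_ge0.
have ba : `|b| <= `|a| by exact: qT.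
pose d := D + h ^+ 2.
have d0 : 0 <= d by rewrite addr_ge0// ltW.
have ad : `|a| <= d by exact: ltW.
have ad2 : `|a| ^+ 2 <= d ^+ 2 by rewrite ler_sqr ?nnegrE.
have bd2 : `|b| ^+ 2 <= d ^+ 2 by rewrite ler_sqr ?nnegrE// (le_trans ba).
have s1' : 0 <= 1 - s by rewrite subr_ge0.
have Nd2 : N ^+ 2 <= d ^+ 2 - s * (1 - s) * (c * D ^+ 2).
  rewrite /N (convex_comb_normE _ _ _ ipn).
  have -> : b - a = - (u t - T (u t)).
    by rewrite /a /b opprB opprB addrA subrK.
  rewrite normrN.
  have t1 := ler_wpM2l s1' ad2; have t2 := ler_wpM2l s0 bd2.
  have t3 := ler_wpM2l (mulr_ge0 s0 s1') subreg.
  lra.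
(* In the cross term with [h * w] the gain is dropped. *)
have Nd : N <= d.
  rewrite -ler_sqr ?nnegrE//; apply: le_trans Nd2 _.
  by rewrite gerBl mulr_ge0 ?mulr_ge0// exprn_ge0.
have t1 : D' ^+ 2 <= (N + h * w) ^+ 2.
  by rewrite ler_sqr ?nnegrE// (le_trans D'0).
have t2 := ler_wpM2r (mulr_ge0 (ltW h0) w0) Nd.
have t3 := ler_wpM2l (ltW h0) hC.
have t4 := ler_wpM2l (ltW h0) De1.
have t5 : h ^+ 2 * h ^+ 2 <= h ^+ 2 by rewrite ger_pMl// exprn_ile1// ltW.
have t6 : h ^+ 2 * (h * w) <= h ^+ 2 * w.
  by apply: ler_wpM2l; [exact: ltW|exact: ler_piMl].
have t7 := ler_wpM2l (ltW h0) (ler_wpM2r (normr_ge0 F) Dr).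
have t8 : D' ^+ 2 <= d ^+ 2 - s * (1 - s) * (c * D ^+ 2) + 2 * (d * (h * w))
   + h ^+ 2 * w ^+ 2 by lra.
have -> : (- (c * th * D ^+ 2) + 2 * r * `|F| + e) * h =
  - (c * th * D ^+ 2 * h) + 2 * (h * (r * `|F|)) + e * h by ring.
rewrite lerBlDr; apply: le_trans t8 _.
have -> : d ^+ 2 - s * (1 - s) * (c * D ^+ 2) + 2 * (d * (h * w))
   + h ^+ 2 * w ^+ 2 = D ^+ 2 - c * th * D ^+ 2 * h + 2 * (h * (D * `|F|)) +
   2 * (h * (D * e1)) + (h ^+ 2 * h ^+ 2 + 2 * (h ^+ 2 * (h * w)) +
   h ^+ 2 * (2 * D + th ^+ 2 * c * D ^+ 2 + w ^+ 2)).
  by rewrite /d /s /w; ring.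
have t9 : h * (h * C) = h ^+ 2 + 2 * (h ^+ 2 * w) +
   h ^+ 2 * (2 * D + th ^+ 2 * c * D ^+ 2 + w ^+ 2) by rewrite /C; ring.
rewrite t9 in t3.
lra.
Unshelve. all: by end_near. Qed.

(** * Integrable representatives and convergence at infinity *)

(** Supplies representatives of the form [primitive] and [gronwall] work with: take the absolute
    value and extend by zero outside [D]. *)
Lemma ae_integrable_ge0_ext (R : realType) (D : set R) (f : R -> R) :
  measurable (D : set (measurableTypeR R)) ->
  (forall t, D t -> 0 <= f t) -> ae_integrable D f ->
  exists h : R -> R, [/\ (@lebesgue_measure R).-integrable setT (EFin \o h),
    forall t, 0 <= h t &
    {ae @lebesgue_measure R, forall t, D t -> f t = h t}].
Proof.
move=> mD f0 [h ih fh]; exists ((fun t => `|h t|) \_ D); split.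
- rewrite -restrict_EFin; apply/(integrable_mkcond _ mD).
  exact: (integrable_abse ih).
- by move=> t; rewrite patchE; case: ifP.
- apply: (@filterS _ _ (ae_filter_ringOfSetsType _)) fh => t + Dt.
  by rewrite patchE mem_set// => /(_ Dt) <-; rewrite ger0_norm// f0.
Qed.

Lemma ge0_ae_eq_Rintegral_nonmeasurable d (X : measurableType d)
    (R : realType) (mu : {measure set X -> \bar R}) (D : set X) (f h : X -> R) :
  measurable D -> measurable_fun D h ->
  (forall x, D x -> 0 <= f x) -> (forall x, D x -> 0 <= h x) ->
  {ae mu, forall x, D x -> f x = h x} ->
  \int[mu]_(x in D) f x = \int[mu]_(x in D) h x.
Proof.
move=> mD mh f0 h0 fh; congr fine.
apply: ge0_ae_eq_integral_nonmeasurable => //.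
- exact/measurable_EFinP.
- by apply: (@filterS _ _ (ae_filter_ringOfSetsType _)) fh => x + Dx => ->.
Qed.

(** From [t0] on, [phi] minus the primitive [K] of [g] is nonincreasing and bounded below; [K] is
    nondecreasing and bounded above. Both converge, hence so does their sum. *)
Lemma ac_dini_cvg (R : realType) (phi g : R -> R) (t0 : R) :
  (@lebesgue_measure R).-integrable setT (EFin \o g) -> (forall t, 0 <= g t) ->
  (forall t, 0 <= phi t) ->
  (forall b, t0 < b -> absolutely_continuous_on t0 b phi) ->
  {ae @lebesgue_measure R, forall t, t0 <= t -> dini_le phi t (g t)} ->
  cvg (phi t @[t --> +oo]).
Proof.
move=> ig g0 phi0 acphi dphi; pose K := primitive g.
have dec p q : t0 <= p -> p <= q -> phi q - K q <= phi p - K p.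
  move=> t0p; rewrite le_eqVlt => /predU1P[->//|pq].
  have acp : absolutely_continuous_on p q phi.
    exact: absolutely_continuous_onS t0p (lexx q) (acphi _ (le_lt_trans t0p pq)).
  have acG : absolutely_continuous_on p q (fun t => phi t - 1 * K t).
    apply: (ac_dominated ler01 ler01 acp (ac_primitive p q ig)) => x y _ _ _.
    rewrite !mul1r (_ : _ - _ - _ = (phi y - phi x) - (K y - K x)); last by ring.
    exact: ler_normB.
  have := ac_dini_le0 (ltW pq) acG; rewrite !mul1r; apply.
  apply: (@filterS2 _ _ (ae_filter_ringOfSetsType _)) dphi (primitive_is_derive ig).
  move=> t dt dK /andP[pt _].
  have := dini_leB ler01 (dt (le_trans t0p pt)) dK.
  by rewrite mul1r subrr.
have Kcvg : cvg (K t @[t --> +oo]).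
  apply/cvg_ex; exists (sup (range K)); apply: nondecreasing_cvgr.
    by move=> x y; exact: primitive_homo.
  by exists (\int[@lebesgue_measure R]_s g s) => _ [y _ <-]; exact: primitive_le.
(* [Num.max] freezes the function before [t0], which makes it monotone on the whole line. *)
pose G t := phi (Num.max t0 t) - K (Num.max t0 t).
have Gcvg : cvg (- G t @[t --> +oo]).
  apply/cvg_ex; eexists; apply: nondecreasing_cvgr.
    move=> x y xy; rewrite lerN2 /G; apply: dec; first by rewrite le_max lexx.
    by rewrite ge_max le_max lexx/= le_max xy orbT.
  exists (\int[@lebesgue_measure R]_s g s) => _ [y _ <-].
  rewrite /G opprB lerBlDl; apply: ler_wpDl => //; exact: primitive_le.
have /cvg_ex[l KGl] : cvg (K t - - G t @[t --> +oo]) by exact: is_cvgB.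
apply/cvg_ex; exists l; apply: cvg_trans KGl; apply: near_eq_cvg.
near=> t; have t0t : t0 <= t by near: t; apply: nbhs_pinfty_ge; rewrite num_real.
by rewrite /= /G (max_idPr t0t); ring.
Unshelve. all: by end_near. Qed.

(** * Assembly of the decay estimate *)

Theorem theorem3p3 (R : realType) (H : completeNormedModType R)
    (ip : {dot H for @idfun R}) (ip_norm : norm_induced_by ip)
    (t0 : R) (t0_gt0 : 0 < t0)
    (theta : R -> R) (theta_ge0 : forall t, t0 <= t -> 0 <= theta t)
    (theta_int : locally_integrable_from t0 theta)
    (f : R -> H) (f_int : bochner_integrable `[t0, +oo[ f)
    (T : H -> H) (T_qne : quasi_nonexpansive T) (T_fix : Fix T !=set0)
    (T_demi : demiclosedness_principle ip T)
    (u : R -> H) (u0 : H) (u_sol : strong_global_solution T theta f t0 u0 u)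
    (uhat : H) (uhat_fix : Fix T uhat) (u_weak : weakly_cvg ip +oo u uhat)
    (r kappa : R) (kappa_gt0 : 0 < kappa)
    (T_subreg : metrically_subregular T uhat r kappa)
    (r_gt : lim (`|u t - uhat| @[t --> +oo]) < r) :
  exists t' M1 : R, [/\ t0 <= t', 0 < M1 &
    forall t : R, t' <= t ->
      dist (u t) (Fix T) ^+ 2 <=
      expR (- (1 / kappa ^+ 2 *
               \int[@lebesgue_measure R]_(s in `[t', t]) theta s)) *
      (M1 * \int[@lebesgue_measure R]_(s in `[t', t])
              (`|f s| *
               expR (1 / kappa ^+ 2 *
                     \int[@lebesgue_measure R]_(x in `[t', s]) theta x)) +
       `|u t' - uhat| ^+ 2)].
Proof.
have [h [ih h0 fh]] : exists h : R -> R,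
    [/\ (@lebesgue_measure R).-integrable setT (EFin \o h), forall t, 0 <= h t &
    {ae @lebesgue_measure R, forall t, `[t0, +oo[%classic t -> `|f t| = h t}].
  by apply: ae_integrable_ge0_ext f_int.2.
have [acu du _] := u_sol.
pose phi t := `|u t - uhat|.
have acphi b : t0 < b -> absolutely_continuous_on t0 b phi.
  move=> /acu acb; apply: (ac_dominated ler01 (lexx 0) acb acb) => x y _ _ _.
  rewrite mul0r addr0 mul1r (le_trans (ler_dist_dist _ _))//.
  by rewrite opprB addrA subrK.
have dphi : {ae @lebesgue_measure R, forall t, t0 <= t -> dini_le phi t (h t)}.
  apply: (@filterS2 _ _ (ae_filter_ringOfSetsType _)) du fh => t dut fht t0t.
  rewrite -fht /= ?in_itv/= ?t0t//.
  exact: dini_dist_fix T_qne uhat_fix (theta_ge0 _ t0t) (dut t0t).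
have phi_cvg : cvg (phi t @[t --> +oo]).
  apply: (ac_dini_cvg ih h0 _ acphi dphi) => s; exact: normr_ge0.
(* The limit of [phi] is below [r], hence so is a tail; [A + 1] turns the open ray given by the
   filter into a closed one. *)
have [t' [t0t' phi_lt]] : exists t', t0 <= t' /\ forall t, t' <= t -> phi t < r.
  have : \forall t \near +oo, phi t < r by exact: (cvgr_lt _ phi_cvg).
  move=> [A [_ Ar]]; exists (Num.max t0 (A + 1)); split; first by rewrite le_max lexx.
  move=> t; rewrite ge_max => /andP[_ At]; apply: Ar.
  by rewrite (lt_le_trans _ At)// ltrDl.
have r0 : 0 < r by rewrite (le_lt_trans _ (phi_lt _ (lexx t')))// normr_ge0.
have dist_phi t : dist (u t) (Fix T) <= phi t by exact: dist_le.
have dist_r t : t' <= t -> dist (u t) (Fix T) <= r.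
  by move=> /phi_lt/ltW; exact: le_trans.
(* Differentiating the squared distance produces twice the distance times the norm of [f], and the
   distance is at most [r] from [t'] on. *)
exists t', (2 * r); split=> //; first by rewrite mulr_gt0.
move=> t t't.
(* As [theta] is only locally integrable, its representative depends on [t]. The endpoint [t + 1]
   keeps the interval nondegenerate when [t] equals [t0]. *)
have [th [ith th0 thetath]] : exists h : R -> R,
    [/\ (@lebesgue_measure R).-integrable setT (EFin \o h), forall t, 0 <= h t &
    {ae @lebesgue_measure R, forall s, `[t0, t + 1]%classic s -> theta s = h s}].
  apply: ae_integrable_ge0_ext => //.
    by move=> s; rewrite /= in_itv/= => /andP[/theta_ge0].
  by apply: theta_int; rewrite (le_lt_trans t0t')// (le_lt_trans t't)// ltrDl.
pose c : R := 1 / kappa ^+ 2.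
have c0 : 0 <= c by rewrite divr_ge0// exprn_ge0// ltW.
have M0 : 0 <= 2 * r by rewrite mulr_ge0// ltW.
have acdist : absolutely_continuous_on t' t (fun s => dist (u s) (Fix T) ^+ 2).
  have act : absolutely_continuous_on t' t u.
    have t1 : t0 < t + 1 by rewrite (le_lt_trans t0t')// (le_lt_trans t't)// ltrDl.
    have tt1 : t <= t + 1 by rewrite lerDl.
    exact: absolutely_continuous_onS t0t' tt1 (acu _ t1).
  (* On values in [[0, r]] squaring is Lipschitz with constant [2 * r], and the distance is
     1-Lipschitz. *)
  apply: (ac_dominated M0 (lexx 0) act act) => x y t'x xy _.
  rewrite mul0r addr0 subr_sqr normrM mulrC.
  apply: ler_pM => //; last exact: dist_lipschitz.
  rewrite ger0_norm ?addr_ge0 ?dist_ge0// mulr_natl mulr2n lerD// dist_r//.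
  exact: le_trans xy.
have ddist : {ae @lebesgue_measure R, forall s, t' <= s < t ->
    dini_le (fun s => dist (u s) (Fix T) ^+ 2) s
      (- (c * th s * dist (u s) (Fix T) ^+ 2) + (2 * r) * h s)}.
  apply: (@filterS3 _ _ (ae_filter_ringOfSetsType _)) du fh thetath.
  move=> s dus fhs ths /andP[t's st]; have t0s := le_trans t0t' t's.
  rewrite -fhs /= ?in_itv/= ?t0s// -ths /= ?in_itv/= ?t0s//=; last first.
    by rewrite (le_trans (ltW st))// lerDl.
  apply: (dini_dist_sqr ip_norm T_qne T_fix (theta_ge0 _ t0s) c0 (dus t0s)).
    (* After [t'] the trajectory stays in the ball; squaring the subregularity estimate there yields
       the rate [c]. *)
    have : dist (u s) (Fix T) <= kappa * `|u s - T (u s)|.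
      by apply: T_subreg; rewrite -ball_normE /ball_/= distrC phi_lt.
    rewrite -ler_sqr ?nnegrE ?dist_ge0// ?mulr_ge0 ?(ltW kappa_gt0)//.
    rewrite exprMn => le1.
    by rewrite /c mulrC div1r ler_pdivrMr ?exprn_gt0// mulrC.
  exact: dist_r.
have thE s : t' <= s <= t -> \int[@lebesgue_measure R]_(x in `[t', s]) theta x =
    \int[@lebesgue_measure R]_(x in `[t', s]) th x.
  move=> /andP[t's st]; apply: ge0_ae_eq_Rintegral_nonmeasurable => //.
  - by apply: measurable_funTS; apply/measurable_EFinP; exact: measurable_int ith.
  - by move=> x; rewrite /= in_itv/= => /andP[/(le_trans t0t')/theta_ge0].
  - apply: (@filterS _ _ (ae_filter_ringOfSetsType _)) thetath => x thx.
    rewrite /= in_itv/= => /andP[t'x xs]; apply: thx; rewrite /= in_itv/=.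
    by rewrite (le_trans t0t')//= (le_trans xs)// (le_trans st)// lerDl.
rewrite -/c thE ?t't ?lexx//.
(* The exponents agree exactly by [thE]; only the norm of [f] changes on a null set. Writing the
   exponent with [primitive] shows that the new integrand is measurable. *)
have -> : \int[@lebesgue_measure R]_(s in `[t', t])
    (`|f s| * expR (c * \int[@lebesgue_measure R]_(x in `[t', s]) theta x)) =
  \int[@lebesgue_measure R]_(s in `[t', t])
    (h s * expR (c * \int[@lebesgue_measure R]_(x in `[t', s]) th x)).
  have mh : measurable_fun `[t', t]%classic
      (fun s => h s * expR (c * (primitive th s - primitive th t'))).
    apply: measurable_funTS; apply: measurable_funM.
      by apply/measurable_EFinP; exact: measurable_int ih.
    apply: nondecreasing_measurable => // x y xy.
    by rewrite ler_expR ler_wpM2l// lerD2r primitive_homo.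
  have hE : {in `[t', t]%classic, (fun s => h s * expR (c *
      \int[@lebesgue_measure R]_(x in `[t', s]) th x)) =1
      (fun s => h s * expR (c * (primitive th s - primitive th t')))}.
    by move=> s /set_mem/=; rewrite in_itv/= => /andP[t's _]; rewrite primitiveB.
  transitivity (\int[@lebesgue_measure R]_(s in `[t', t])
      (h s * expR (c * (primitive th s - primitive th t')))); last first.
    by apply: eq_Rintegral => s /hE.
  apply: ge0_ae_eq_Rintegral_nonmeasurable => //.
  - by move=> x _; rewrite mulr_ge0// expR_ge0.
  - apply: (@filterS _ _ (ae_filter_ringOfSetsType _)) fh => x fhx.
    rewrite /= in_itv/= => /andP[t'x xt].
    rewrite fhx /= ?in_itv/= ?(le_trans t0t')// thE ?t'x//.
    by rewrite primitiveB.
have bnd s : t' <= s <= t -> 0 <= dist (u s) (Fix T) ^+ 2 <= r ^+ 2.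
  move=> /andP[t's _]; rewrite exprn_ge0 ?dist_ge0//= ler_sqr ?nnegrE ?dist_ge0//.
  - exact: dist_r.
  - exact: ltW.
have := gronwall t't c0 M0 bnd acdist th0 h0 ith ih ddist.
(* What remains is the initial value: the distance at [t'] is at most that to the fixed point
   [uhat]. *)
move=> /le_trans; apply; rewrite ler_wpM2l ?expR_ge0// lerD2l.
by rewrite ler_sqr ?nnegrE ?dist_ge0// dist_phi.
Qed.
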